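(* Let $\mathfrak{F}=\langle W,R\rangle$ be a directed graph, let $I$ be a set with $|I|\geq\aleph_0$, and let $D$ be an $\aleph_1$-incomplete ultrafilter over $I$. The following are equivalent: (i) $\mathfrak{F}$ is $\deg^+$-finite, i.e. $|\{s\in W:Rws\}|<\omega$ for every $w\in W$; (ii) $\mathfrak{F}\trianglelefteq\mathfrak{F}^{\mathfrak{ue}}$; (iii) $\mathfrak{F}\trianglelefteq {}^I\mathfrak{F}/D$.
   Context: For $X\subseteq W$ let $R^-(X)=\{w\in W:\exists s\,(Rws\wedge s\in X)\}$. The ultrafilter extension is $\mathfrak{F}^{\mathfrak{ue}}=\langle \mathrm{Uf}(W),R^{\mathfrak{ue}}\rangle$, where $\mathrm{Uf}(W)$ is the set of ultrafilters over $W$ and $R^{\mathfrak{ue}}uv$ iff $R^-(X)\in u$ for all $X\in v$; $\mathfrak{F}$ is identified with its image under the canonical embedding $w\mapsto\pi_w=\{X\subseteq W:w\in X\}$. ${}^I\mathfrak{F}/D$ is the ultrapower, and $\mathfrak{F}$ is identified with its image under the diagonal embedding $w\mapsto[c_w]_D$ ($c_w$ the constant function with value $w$). For graphs $\mathfrak{F}'=\langle W',R'\rangle$ and $\mathfrak{G}=\langle V,S\rangle$, $\mathfrak{F}'\trianglelefteq\mathfrak{G}$ ($\mathfrak{F}'$ is a generated substructure of $\mathfrak{G}$) means $\mathfrak{F}'$ is a substructure of $\mathfrak{G}$ and for all $w'\in W'$ and $v\in V$, $Sw'v$ implies $v\in W'$. *)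

(* Defs.v *)
From mathcomp Require Import all_boot all_order.
From mathcomp Require Import boolp classical_sets functions cardinality filter.

Set Implicit Arguments.
Unset Strict Implicit.
Unset Printing Implicit Defensive.

Local Open Scope classical_set_scope.

Record digraph := Digraph {
  vertex :> Type;
  edge : vertex -> vertex -> Prop
}.

Definition out_neighbours (F : digraph) (w : F) : set F := [set s | edge w s].

Definition out_degree_finite (F : digraph) : Prop :=
  forall w : F, finite_set (out_neighbours w).

Definition embedding (F G : digraph) (e : F -> G) : Prop :=
  injective e /\ forall w s : F, edge w s <-> edge (e w) (e s).

(* "F is a generated substructure of G", where F is identified with its image
   under e: the image is an isomorphic copy of F that is an induced subgraph
   of G, closed under the edges of G. *)
Definition generated_substructure (F G : digraph) (e : F -> G) : Prop :=
  embedding e /\ forall (w : F) (v : G), edge (e w) v -> range e v.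

Section UltrafilterExtension.
Variable F : digraph.

Definition predecessors (X : set F) : set F :=
  [set w | exists s, edge w s /\ X s].

Definition uf (T : Type) : Type := {u : set_system T | UltraFilter u}.

Definition ultrafilter_extension : digraph :=
  @Digraph (uf F) (fun u v => forall X : set F, sval v X -> sval u (predecessors X)).

Definition ue_embedding (w : F) : ultrafilter_extension :=
  exist _ (principal_filter w) (principal_filter_ultra w).

End UltrafilterExtension.

Section Ultrapower.
Variables (F : digraph) (I : Type) (D : set_system I).

Definition up_class (f : I -> F) : set (I -> F) :=
  [set g | D [set i | f i = g i]].

(* The vertices are the equivalence classes of functions I -> F modulo D. *)
Definition up_vertex : Type := {A : set (I -> F) | exists f, A = up_class f}.

Definition up_mk (f : I -> F) : up_vertex :=
  exist _ (up_class f) (ex_intro _ f erefl).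

Definition ultrapower : digraph :=
  @Digraph up_vertex (fun a b => exists f g,
    [/\ sval a f, sval b g & D [set i | edge (f i) (g i)]]).

Definition up_embedding (w : F) : ultrapower := up_mk (fun=> w).

Lemma up_mk_eq (FD : Filter D) (f g : I -> F) :
  up_mk f = up_mk g <-> D [set i | f i = g i].
Proof.
have mk_eq : up_class f = up_class g -> up_mk f = up_mk g.
  by rewrite /up_mk => E; apply: eq_exist.
split=> [E|Dfg].
  have : up_class f f by apply: (@filterS _ D _ setT) => //; exact: filterT.
  have /(congr1 sval)/= -> := E; rewrite /up_class/=.
  by apply: filterS => i /= ->.
apply: mk_eq; rewrite predeqE => h; rewrite /up_class/=; split=> Dh.
  by apply: (filterS _ (filterI Dfg Dh)) => i /= [-> ].
by apply: (filterS _ (filterI Dfg Dh)) => i /= [-> ].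
Qed.

Lemma up_edgeE (FD : Filter D) (f g : I -> F) :
  @edge ultrapower (up_mk f) (up_mk g) <-> D [set i | edge (f i) (g i)].
Proof.
split=> [[f' [g' [/= Df Dg De]]]|De].
  by apply: (filterS _ (filterI Df (filterI Dg De))) => i /= [-> [->]].
have refl h : up_class h h.
  by apply: (@filterS _ D _ setT) => //; exact: filterT.
by exists f, g; split=> //; exact: refl.
Qed.

End Ultrapower.

(* D is aleph_1-complete if it is closed under intersections of fewer than
   aleph_1, i.e. countably many, of its members. *)
Definition aleph1_complete (I : Type) (D : set_system I) : Prop :=
  forall E : set (set I), countable E -> E `<=` D -> D (\bigcap_(X in E) X).

Definition aleph1_incomplete (I : Type) (D : set_system I) : Prop :=
  ~ aleph1_complete D.

(* Main.v *)
Require Import Defs.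
From mathcomp Require Import all_boot all_order.
From mathcomp Require Import boolp classical_sets functions cardinality filter.

(** Let A be the set of out-neighbours of w.  The successors of the principal
    ultrafilter of w in the ultrafilter extension are the ultrafilters
    containing A, and the successors of [c_w] in the ultrapower are the classes
    [g] with g(i) in A for D-almost all i.  If A is finite, an ultrafilter
    concentrates each of these on a single point of A.  If A is infinite, the
    sets containing all but finitely many points of A generate a
    non-principal ultrafilter containing A, and aleph_1-incompleteness gives a
    map I -> nat that is constant on no member of D, which composed with an
    injection nat -> A gives a class [g] outside the diagonal. *)

Local Open Scope classical_set_scope.
Local Open Scope card_scope.

(** Points of [A] are discarded one by one: [D] contains the fibre over [t] or its complement, hence
    the preimage of the remaining points. Not all can go, since [D] is proper. *)
Lemma ultra_finite_preimage {I T : Type} (D : set_system I) (g : I -> T)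
    (A : set T) :
  UltraFilter D -> finite_set A -> D (g @^-1` A) ->
  exists t, D [set i | g i = t].
Proof.
move=> DU /(@finite_seqP {classic T})[s ->].
elim: s => [|t s IHs] Ds; first by case: (@filter_ex _ _ _ _ Ds).
have [Dt|Dt] := in_ultra_setVsetC [set i | g i = t] DU; first by exists t.
apply: IHs; apply: filterS (filterI Ds Dt) => i /= [].
by rewrite inE => /orP[/eqP|].
Qed.

Lemma nonprincipal_ultra {T : Type} (A : set T) :
  infinite_set A ->
  exists U : set_system T,
    [/\ UltraFilter U, U A & forall t, ~ U [set t]].
Proof.
move=> Ainf; pose C : set_system T := [set X | finite_set (A `\` X)].
have CP : ProperFilter C.
  split; first by rewrite /C/= setD0.
  split.
  - by rewrite /C/= setDT.
  - by move=> X Y CX CY; rewrite /C/= setDIr finite_setU.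
  - by move=> X Y XY; apply: sub_finite_set; exact: setDS.
have [U [UU CU]] := ultraFilterLemma CP.
exists U; split=> //; first by apply: CU; rewrite /C/= setDv.
move=> t Ut; have Ut' : U (~` [set t]).
  apply: CU; apply: sub_finite_set (finite_set1 t).
  by move=> x [_ /contrapT].
by have [x [/= + xt]] := filter_ex (filterI Ut Ut').
Qed.

(** Send [i] to the code of a chosen member of [E] missing [i]. Off the intersection of [E], a fibre
    in [D] would be disjoint from that member, itself in [D]. *)
Lemma aleph1_incomplete_map {I : Type} (D : set_system I) :
  UltraFilter D -> aleph1_incomplete D ->
  exists h : I -> nat, forall k, ~ D [set i | h i = k].
Proof.
move=> DU /existsNP[E /not_implyP[/countable_injP[f finj]]].
move=> /not_implyP[ED NDE].
have [//|DE] := in_ultra_setVsetC (\bigcap_(X in E) X) DU.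
have /choice[h hP] (i : I) :
    exists X, (~` \bigcap_(Y in E) Y) i -> E X /\ ~ X i.
  have [Ei|/existsNP[X /not_implyP XP]] := pselect ((\bigcap_(Y in E) Y) i).
    (* Arbitrary default: the complement of the intersection is in [D], so these points are avoided
       below. *)
    by exists setT.
  by exists X.
exists (f \o h) => k Dk.
have {Dk DE} DkE : D ([set i | (f \o h) i = k] `&` ~` \bigcap_(X in E) X).
  exact: filterI.
have [i [/= fi /hP[Ei _]]] := filter_ex DkE.
have [j [[/= fj /hP[Ej nj]] hj]] := filter_ex (filterI DkE (ED _ Ei)).
by apply: nj; rewrite (finj (h j) (h i)) ?inE // fi fj.
Qed.

Lemma ue_embeddingP (F : digraph) : embedding (@ue_embedding F).
Proof.
split=> [w s /(congr1 sval)/= E|w s].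
  have /principal_filterP // : principal_filter w [set s].
  by rewrite E; exact/principal_filterP.
split=> [ws X /principal_filterP Xs|/(_ [set s])].
  by apply/principal_filterP; exists s.
move=> /(_ (proj2 (principal_filterP _ _) erefl)) /principal_filterP.
by move=> [t [wt ts]]; rewrite -ts.
Qed.

Lemma ue_edgeE (F : digraph) (w : F) (v : ultrafilter_extension F) :
  edge (ue_embedding w) v <-> sval v (out_neighbours w).
Proof.
case: v => v vU /=; split=> [wv|vA X vX].
  (* Otherwise [v] contains the complement of the out-neighbours, and [w] would have an edge into
     it. *)
  by have [|/wv/principal_filterP[s []]] :=
    in_ultra_setVsetC (out_neighbours w) vU.
have [s [ws Xs]] := filter_ex (filterI vA vX).
by apply/principal_filterP; exists s.
Qed.

Lemma generated_ueP (F : digraph) :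
  generated_substructure (@ue_embedding F) <-> out_degree_finite F.
Proof.
split=> [[_ gen] w|fin].
  apply: contrapT => /nonprincipal_ultra[U [UU UA nU]].
  have /ue_edgeE/gen[s _ /(congr1 sval)/= E] :
    sval (exist _ U UU : ultrafilter_extension F) (out_neighbours w) by [].
  by apply: (nU s); rewrite -E; exact/principal_filterP.
split=> [|w v /ue_edgeE]; first exact: ue_embeddingP.
case: v => v vU /= /(ultra_finite_preimage _ id _ vU (fin w))[s vs].
exists s => //; apply: eq_exist.
(* By maximality of ultrafilters, it is enough that [v] contains every set to which [s] belongs. *)
apply: esym; apply: (@max_filter _ _ (principal_filter_ultra s)) => X.
move=> /principal_filterP Xs.
by apply: filterS vs => _ ->.
Qed.

Lemma up_embeddingP (F : digraph) (I : Type) (D : set_system I) :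
  ProperFilter D -> embedding (@up_embedding F I D).
Proof.
move=> DP; split=> [w s /up_mk_eq E|w s]; first by have [] := filter_ex E.
split=> [ws|/up_edgeE E]; last by have [] := filter_ex E.
by apply/up_edgeE; apply: filterS filterT.
Qed.

Lemma generated_upP (F : digraph) (I : Type) (D : set_system I) :
  UltraFilter D -> aleph1_incomplete D ->
  generated_substructure (@up_embedding F I D) <-> out_degree_finite F.
Proof.
move=> DU Dinc; split=> [[_ gen] w|fin].
  apply: contrapT => /infiniteP/card_leP[a].
  have [h hP] := aleph1_incomplete_map _ DU Dinc.
  pose b n := set_val (a (to_setT n)) : F.
  have b_inj : injective b.
    move=> m n /val_inj /(inj (in_setT _) (in_setT _)).
    by move/(congr1 set_val).
  have /gen[s _ /up_mk_eq Ds] :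
      edge (up_embedding D w) (up_mk D (b \o h)).
    apply/up_edgeE; apply: filterS filterT => i _ /=.
    exact: (set_valP (a (to_setT (h i)))).
  (* Since [b] is injective, [b \o h] being [D]-almost constant would make [h] constant on a member
     of [D]. *)
  have [i /= si] := filter_ex Ds.
  by apply: (hP (h i)); apply: filterS Ds => j /=; rewrite si => /b_inj.
split=> [|w [A gA]]; first exact: up_embeddingP.
have [g Ag] := gA; rewrite (_ : exist _ A gA = up_mk D g); last exact: eq_exist.
move=> /up_edgeE Dg.
have [s Ds] := ultra_finite_preimage _ g _ DU (fin w) Dg.
by exists s => //; apply/up_mk_eq; apply: filterS Ds => i /= ->.
Qed.

Theorem theorem3p3 (F : digraph) (I : Type) (D : set_system I)
    (I_infinite : [set: nat] #<= [set: I])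
    (D_ultra : UltraFilter D) (D_incomplete : aleph1_incomplete D) :
  [<-> out_degree_finite F;
       generated_substructure (@ue_embedding F);
       generated_substructure (@up_embedding F I D)].
Proof.
tfae.
- by move/generated_ueP.
- by move/generated_ueP => fin; exact/generated_upP.
- by move/generated_upP; apply.
Qed.
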